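(* Let $F=\mathbb{Q}(\zeta_8)$, $K=\mathbb{Q}(\zeta_8+\zeta_8^{-1})$, $\Lambda=\frac{1-\zeta_8}{2}\mathbb{Z}_F$, and let $C$ be a Euclidean self-dual code of length $n\ge1$ over $\mathbb{F}_2+u\mathbb{F}_2$. Then $$\theta_C=W_C(\theta_0,\theta_1,\theta_u)$$ as functions on $\mathbb{H}^{\oplus2}$, where $W_C$, $\theta_C$ and $\theta_a$ are defined in the context.
   Context: $\zeta_8=\exp(2\pi\sqrt{-1}/8)$; $\mathbb{Z}_F$ is the ring of integers of $F$; $\mathbb{H}$ is the upper half plane; bar is complex conjugation. $\mathrm{Gal}(K/\mathbb{Q})=\{\sigma_1=\mathrm{id},\sigma_2\}$. **The lattice.** $\Lambda$ carries the form $(x,y)\mapsto\mathrm{Tr}_{F/\mathbb{Q}}(x\bar y)$. It has $\mathbb{Z}$-basis $f_i=\frac{1-\zeta_8}{2}\zeta_8^{i-1}$ ($1\le i\le4$), and its dual $\Lambda^*=\{x\in F:\mathrm{Tr}_{F/\mathbb{Q}}(x\bar y)\in\mathbb{Z}\ \forall y\in\Lambda\}=\frac1{2(1-\zeta_8)}\mathbb{Z}_F$ has the dual basis $f_i^*=\frac{1}{2(1-\zeta_8^{-1})}\zeta_8^{i-1}$. **Codes.** $\mathbb{F}_2+u\mathbb{F}_2=\{0,1,u,1+u\}$ is the ring of characteristic two with $u^2=0$. A code of length $n$ over it is a submodule $C$ of $(\mathbb{F}_2+u\mathbb{F}_2)^{\oplus n}$; it is Euclidean self-dual if $C=C^\perp=\{x:\sum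 x_iy_i=0\ \forall y\in C\}$. Define the additive map $\rho^{\oplus n}:(\Lambda^* )^{\oplus n}\to(\mathbb{F}_2+u\mathbb{F}_2)^{\oplus n}$ by $$\Big(\sum_{j=1}^4x_{ij}f_j^*\Big)_{1\le i\le n}\mapsto\big((x_{i1}+x_{i3}\bmod2)+(x_{i2}+x_{i4}\bmod 2)(1+u)\big)_{1\le i\le n}\qquad(x_{ij}\in\mathbb{Z}),$$ and $\Gamma_C=(\rho^{\oplus n})^{-1}(C)\subset F^{\oplus n}$. For $x\in(\mathbb{F}_2+u\mathbb{F}_2)^{\oplus n}$ let $N_0(x)$ be the number of coordinates equal to $0$, $N_2(x)$ the number equal to $u$, $N_1(x)=n-N_0(x)-N_2(x)$. The weight enumerator is $W_C(X_0,X_1,X_2)=\sum_{x\in C}X_0^{N_0(x)}X_1^{N_1(x)}X_2^{N_2(x)}$. **Theta functions.** On $F^{\oplus n}$ put $v\cdot w=\sum_{i=1}^n(v_i\overline{w_i}+\overline{v_i}w_i)\in K$. For $z=(z_1,z_2)\in\mathbb{H}^{\oplus2}$ put $\mathrm{Tr}_{K/\mathbb{Q}}(zx^2)=\sum_{l=1}^2z_l\sigma_l(x\cdot x)$. Let $x_0=0$, $x_1=f_1^*$, $x_{1+u}=f_2^*$, $x_u=f_1^*+f_2^*$. For $a\in\mathbb{F}_2+u\mathbb{F}_2$, $$\theta_a(z)=\sum_{x\in x_a+\Lambda}\exp(\pi\sqrt{-1}\,\mathrm{Tr}_{K/\mathbb{Q}}(zx^2)),\qquad\theta_C(z)=\sum_{x\in\Gamma_C}\exp(\pi\sqrt{-1}\,\mathrm{Tr}_{K/\mathbb{Q}}(zx^2)).$$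 *)

(* Defs.v *)
From mathcomp Require Import all_boot all_order all_algebra all_fingroup all_field.
From mathcomp Require Import complex.
From mathcomp Require Import all_classical all_reals all_analysis.
From mathcomp.analysis.showcase Require summability.

Set Implicit Arguments.
Unset Strict Implicit.
Unset Printing Implicit Defensive.

Import Order.TTheory GRing.Theory Num.Theory.
Import numFieldNormedType.Exports.

Local Open Scope classical_set_scope.
Local Open Scope ring_scope.

Section ComplexNumbers.
Variable R : realType.

Definition cexp (w : R[i]) : R[i] :=
  (expR (complex.Re w))%:C%C *
  (cos (complex.Im w) +i* sin (complex.Im w))%C.

Definition upper_half_plane : set R[i] := [set z | 0 < complex.Im z].

(* Unordered sum of [f] over [D]: limit of the finite partial sums along the
   net of finite sets ordered by inclusion (terms outside [D] replaced by 0). *)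
Definition csum (I : choiceType) (D : set I) (f : I -> R[i]) : R[i] :=
  @summability.sum I R[i] (R[i])^o (fun x => if x \in D then f x else 0).

End ComplexNumbers.

(* F_2 + u F_2 as F_2[X]/(X^2), with u the class of X. *)
Definition F2u := {poly %/ ('X^2 : {poly 'F_2})}.
Definition u : F2u := qpolyX 'X^2.

Section Codes.
Variable n : nat.

Definition is_code (C : {set 'rV[F2u]_n}) := submod_closed C.

Definition dual_code (C : {set 'rV[F2u]_n}) : {set 'rV[F2u]_n} :=
  [set x : 'rV[F2u]_n | [forall y in C, \sum_i x 0 i * y 0 i == 0]]%SET.

Definition self_dual (C : {set 'rV[F2u]_n}) := C = dual_code C.

Definition N0 (x : 'rV[F2u]_n) : nat := #|[set i | x 0 i == 0]%SET|.
Definition N2 (x : 'rV[F2u]_n) : nat := #|[set i | x 0 i == u]%SET|.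
Definition N1 (x : 'rV[F2u]_n) : nat := (n - N0 x - N2 x)%N.

Definition weight_enumerator (S : comNzRingType) (C : {set 'rV[F2u]_n})
    (X0 X1 X2 : S) : S :=
  \sum_(x in C) X0 ^+ N0 x * X1 ^+ N1 x * X2 ^+ N2 x.

End Codes.

(* [F], generated over Q by [zeta], is embedded in C by [iota]; it is the
   cyclotomic field Q(zeta_8) when [iota zeta = exp(2 pi i / 8)]. *)
Section Lattice.
Variables (R : realType) (F : splittingFieldType rat) (zeta : F).
Variable iota : {rmorphism F -> R[i]}.

Definition ringOfIntegers : set F := [set x | integralOver (intr : int -> F) x].

(* Complex conjugation transported to [F]. *)
Definition bar (x : F) : F := xget 0 [set y | iota y = (iota x)^*].

Definition TrF (x : F) : F := galTrace 1%AS {:F}%AS x.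

Definition Lambda : set F :=
  [set (1 - zeta) / 2%:R * y | y in ringOfIntegers].

Definition Lambda_dual : set F :=
  [set x | forall y, Lambda y -> exists k : int, TrF (x * bar y) = k%:~R].

(* Indices start at 0: [fstar j] is f_{j+1}^*. *)
Definition fstar (j : 'I_4) : F := (2%:R * (1 - zeta^-1))^-1 * zeta ^+ j.

(* On [Lambda_dual] the rational coordinates in the basis [fstar] are
   integers, and [numq] merely reads them as such. *)
Definition fcoord (x : F) (j : 'I_4) : int :=
  numq (coord [tuple fstar k | k < 4] j x).

Definition rho1 (x : F) : F2u :=
  (fcoord x (inord 0) + fcoord x (inord 2))%:~R
  + (fcoord x (inord 1) + fcoord x (inord 3))%:~R * (1 + u).

(* Meaningful on vectors with entries in [Lambda_dual] only. *)
Definition rho (n : nat) (v : 'rV[F]_n) : 'rV[F2u]_n := \row_i rho1 (v 0 i).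

Definition Gamma (n : nat) (C : {set 'rV[F2u]_n}) : set 'rV[F]_n :=
  [set v : 'rV[F]_n | (forall i, Lambda_dual (v 0 i)) /\ rho v \in C].

Definition dot (n : nat) (v w : 'rV[F]_n) : F :=
  \sum_i (v 0 i * bar (w 0 i) + bar (v 0 i) * w 0 i).

Definition K : {subfield F} := <<1; zeta + zeta^-1>>%AS.

(* [sigma1 = id] and [sigma2] are the elements of Gal(K/Q). *)
Variable sigma2 : gal_of K.

(* Tr_{K/Q}(z x^2) *)
Definition TrK (z : R[i] * R[i]) (n : nat) (x : 'rV[F]_n) : R[i] :=
  z.1 * iota ((1%g : gal_of K) (dot x x)) + z.2 * iota (sigma2 (dot x x)).

Definition theta (n : nat) (D : set 'rV[F]_n) (z : R[i] * R[i]) : R[i] :=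
  csum D (fun x => cexp ((pi : R)%:C%C * 'i * TrK z x)).

Definition coset_rep (a : F2u) : F :=
  if a == 0 then 0
  else if a == 1 then fstar (inord 0)
  else if a == 1 + u then fstar (inord 1)
  else fstar (inord 0) + fstar (inord 1).

Definition theta_elt (a : F2u) : R[i] * R[i] -> R[i] :=
  theta [set x : 'rV[F]_1 | Lambda (x 0 0 - coset_rep a)].

Definition theta_code (n : nat) (C : {set 'rV[F2u]_n}) :
    R[i] * R[i] -> R[i] :=
  theta (Gamma C).

End Lattice.

(* Main.v *)
Require Import Defs.
From mathcomp Require Import all_boot all_order all_algebra all_fingroup all_field.
From mathcomp Require Import complex.
From mathcomp Require Import all_classical all_reals all_analysis.
From mathcomp Require Import finmap ring lra zify.
From mathcomp.analysis.showcase Require Import summability.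

Set Implicit Arguments.
Unset Strict Implicit.
Unset Printing Implicit Defensive.

Import Order.TTheory GRing.Theory Num.Theory.
Import numFieldNormedType.Exports.

Local Open Scope classical_set_scope.
Local Open Scope ring_scope.

(**
A vector [v] over [Lambda^*] lies in [Gamma_C] exactly when [rho v] is some
codeword [c], and then each coordinate [v_i] lies in the coset [x_{c_i} + Lambda].
Hence [Gamma_C] is the disjoint union, over [c] in [C], of the products of
these cosets.  The exponent of the theta series is a sum over the coordinates,
so the summand is a product over the coordinates, and summing a product of
functions of separate variables gives

    theta_C = sum_{c in C} prod_i theta_{c_i}.

Multiplication by [zeta] preserves [Lambda] and [x * bar x] and sends
[f_1^*] to [f_2^*], so [theta_{1+u} = theta_1]; grouping equal factors then
yields the weight enumerator.  Three things have to be supplied.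

Convergence.  The sums are limits along finite subsets, which only multiply
well when the families are absolutely summable ([has_sum_prod]).  For
[x = sum a_j zeta^j] both conjugates of [x * bar x] are nonnegative and their
sum is [2 (a_0^2 + ... + a_3^2)] ([iota_qnorms]), because [sigma2] negates
the square root of 2; on [Lambda^*] the numbers [4 a_j] are integers, so the
terms are dominated by a product of four geometric sequences
([theta_term_bound], [lattice_psum_le]).

The ring of integers.  [Lambda] is defined from all integers of [F], so one
needs that they are the integral combinations of [1, zeta, zeta^2, zeta^3]
([ringOfIntegersP]).  The trace shows that four times an integer is such a
combination; the denominators 2 are removed with the element [1 - zeta], whose
fourth power is an associate of 2 ([zpi_step]).

The fibres of [rho].  The trace form identifies [Lambda^*] with the integral
span of the [f_j^*] ([Lambda_dualP]), and [Lambda] inside it is cut out by the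
two parity conditions that [rho] reads off ([Lambda_fscale],
[Lambda_cosetP]).
*)

(** * Unordered sums *)

#[local] Existing Instance totally_filter.

Section UnorderedSums.
Variables (K : numFieldType) (I : choiceType).
Implicit Types (f g : I -> K) (s t : K) (A B : {fset I}).

(** Convergence along the net of finite subsets is stated as a relation, because
the total sum operator is meaningless unless the limit exists. *)
Definition has_sum f s := partial_sum f @ totally --> (s : K^o).

Lemma psumE f A : partial_sum f A = \sum_(i <- A) f i.
Proof. by rewrite /partial_sum [RHS]big_seq_fsetE. Qed.

Lemma has_sumP f s :
  has_sum f s <->
  forall e : K, 0 < e ->
    exists A, forall B, (A `<=` B)%fset -> `|s - partial_sum f B| < e.
Proof.
rewrite /has_sum; split.
  move=> /(@cvgrPdist_lt K K^o) h e e0.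
  by have [A _ hA] := h e e0; exists A.
move=> h; apply/(@cvgrPdist_lt K K^o) => e e0.
by have [A hA] := h e e0; exists A.
Qed.

Lemma sum_has_sum f s : has_sum f s -> @summability.sum I K K^o f = s.
Proof.
by move=> fs; apply: cvg_lim => //; exact: (@norm_hausdorff K K^o).
Qed.

Lemma has_sumD f g s t :
  has_sum f s -> has_sum g t -> has_sum (fun i => f i + g i) (s + t).
Proof.
move=> fs gt; rewrite /has_sum.
rewrite [X in X @ _](_ : _ = partial_sum f + partial_sum g :> ({fset I} -> K^o)).
  exact: cvgD.
by apply/funext => A; rewrite /partial_sum /= big_split.
Qed.

Lemma has_sum0 : has_sum (fun=> 0) 0.
Proof.
rewrite /has_sum [X in X @ _](_ : _ = fun=> 0 : K^o); first exact: cvg_cst.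
by apply/funext => A; rewrite /partial_sum /= big1.
Qed.

Lemma has_sumZ f s c : has_sum f s -> has_sum (fun i => c * f i) (c * s).
Proof.
move=> fs; rewrite /has_sum.
rewrite [X in X @ _](_ : _ = fun A => (c : K^o) *: (partial_sum f A : K^o)).
  by apply: cvgZ fs; exact: cvg_cst.
by apply/funext => A; rewrite /partial_sum /= -mulr_sumr.
Qed.

Lemma has_sum_sum (J : Type) (r : seq J) (P : pred J) (f : J -> I -> K) (s : J -> K) :
  (forall j, P j -> has_sum (f j) (s j)) ->
  has_sum (fun i => \sum_(j <- r | P j) f j i) (\sum_(j <- r | P j) s j).
Proof.
move=> fs; elim: r => [|j r IH].
  by rewrite big_nil; under eq_fun do rewrite big_nil; exact: has_sum0.
rewrite big_cons; under eq_fun do rewrite big_cons.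
by case: ifP => // Pj; apply: has_sumD => //; exact: fs.
Qed.

End UnorderedSums.

Lemma has_sum_bij (K : numFieldType) (I J : choiceType) (h : J -> I) h'
    (f : I -> K) s :
  cancel h h' -> cancel h' h -> has_sum f s -> has_sum (f \o h) s.
Proof.
move=> hK h'K /has_sumP fs; apply/has_sumP => e /fs[A hA].
exists [fset h' i | i in A]%fset => B AB.
have -> : partial_sum (f \o h) B = partial_sum f [fset h i | i in B]%fset.
  by rewrite !psumE big_imfset //= => x y _ _; exact: (can_inj hK).
apply: hA; apply/fsubsetP => i iA.
rewrite -(h'K i); apply/imfsetP; exists (h' i) => //=.
by apply: (fsubsetP AB); apply/imfsetP; exists i.
Qed.

Section Product.
Variables (K : numFieldType) (T : choiceType) (n : nat).

Definition box (A : {fset T}) : {fset 'rV[T]_n} :=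
  [fset (\row_i val (h i)) | h : {ffun 'I_n -> A} in [set: {ffun 'I_n -> A}]%SET]%fset.

Lemma mem_box A x : (x \in box A) = [forall i, x 0 i \in A].
Proof.
apply/imfsetP/forallP => /= [[h _ ->] i|xA]; first by rewrite mxE fsvalP.
exists [ffun i => [` xA i]%fset]; first by rewrite inE.
by apply/rowP => i; rewrite mxE ffunE.
Qed.

Lemma psum_box (f : 'I_n -> T -> K) A :
  partial_sum (fun x : 'rV[T]_n => \prod_i f i (x 0 i)) (box A) =
  \prod_i partial_sum (f i) A.
Proof.
rewrite psumE /partial_sum bigA_distr_bigA big_imfset /=; last first.
  move=> g h _ _ /rowP gh; apply/ffunP => i; apply: val_inj.
  by have := gh i; rewrite !mxE.
rewrite big_enum; apply: eq_big => [h|h _]; first by rewrite inE.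
by apply: eq_bigr => i _; rewrite mxE.
Qed.

Lemma box_cofinal (B : {fset 'rV[T]_n}) : exists A, (B `<=` box A)%fset.
Proof.
exists [fset (b : 'rV[T]_n) 0 i | b in B, i in 'I_n]%fset.
apply/fsubsetP => x xB; rewrite mem_box; apply/forallP => i.
by apply/imfset2P; exists x => //; exists i.
Qed.

Lemma boxS A B : (A `<=` B)%fset -> (box A `<=` box B)%fset.
Proof.
move=> AB; apply/fsubsetP => x; rewrite !mem_box => /forallP xA.
by apply/forallP => i; exact: (fsubsetP AB).
Qed.

(** Sums over a box [A^n] factor exactly.  An arbitrary finite set containing
the box lies in a larger box, and the difference is bounded by the increment
from one box to the other of the products of the sums of absolute values; it is
small because these products converge. *)
Lemma has_sum_prod (f : 'I_n -> T -> K) (s S : 'I_n -> K) :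
  (forall i, has_sum (f i) (s i)) ->
  (forall i, has_sum (fun x => `|f i x|) (S i)) ->
  has_sum (fun x : 'rV[T]_n => \prod_i f i (x 0 i)) (\prod_i s i).
Proof.
move=> fs fS; apply/has_sumP => e e0.
pose g i x := `|f i x|.
have cvg_pr (h : 'I_n -> T -> K) (a : 'I_n -> K) :
    (forall i, has_sum (h i) (a i)) -> forall e : K, 0 < e ->
    exists A, forall B, (A `<=` B)%fset ->
    `|\prod_i a i - \prod_i partial_sum (h i) B| < e.
  move=> ha d d0.
  have : (fun A => \prod_i partial_sum (h i) A) @ totally --> (\prod_i a i : K^o).
    apply: (@cvg_big K^o _ *%R 1 _ (@mul_continuous K)).
    by move=> i _; exact: ha.
  by move=> /(@cvgrPdist_lt K K^o)/(_ d d0)[A _ hA]; exists A.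
(* One quarter for the box itself, two for the increment between boxes. *)
have e4 : 0 < e / 4%:R by rewrite divr_gt0.
have [A1 hA1] := cvg_pr _ _ fs _ e4.
have [A2 hA2] := cvg_pr _ _ fS _ e4.
pose A := (A1 `|` A2)%fset.
exists (box A) => B AB.
have [A' BA'] := box_cofinal B.
have AA' : (A `<=` A `|` A')%fset by apply: fsubsetUl.
have BAA' : (B `<=` box (A `|` A'))%fset.
  by apply: fsubset_trans BA' _; apply: boxS; apply: fsubsetUr.
set F := fun x : 'rV[T]_n => _.
pose G := fun x : 'rV[T]_n => \prod_i g i (x 0 i).
have FG x : `|F x| = G x by rewrite normr_prod.
have sub_psum (H : 'rV[T]_n -> K) (B1 B2 : {fset 'rV[T]_n}) : (B1 `<=` B2)%fset ->
    partial_sum H B2 - partial_sum H B1 = \sum_(x <- (B2 `\` B1)%fset) H x.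
  move=> B12; rewrite !psumE (big_fsetID _ (mem B1) B2) /= addrC.
  rewrite (_ : [fset x in B2 | x \in B1]%fset = B1) ?addrK; last first.
    apply/fsetP => x; rewrite !inE /= andbC.
    by case: (boolP (x \in B1)) => // /(fsubsetP B12) ->.
  rewrite (_ : [fset x in B2 | x \notin B1]%fset = (B2 `\` B1)%fset) //.
  by apply/fsetP => x; rewrite !inE /= andbC.
have h1 : `|partial_sum F B - partial_sum F (box A)| <=
          partial_sum G (box (A `|` A')%fset) - partial_sum G (box A).
  rewrite !sub_psum //; last exact: boxS.
  apply: le_trans (ler_norm_sum _ _ _) _.
  under eq_bigr do rewrite FG.
  rewrite -subr_ge0 -!psumE sub_psum ?fsetSD // big_seq.
  by apply: sumr_ge0 => x _; rewrite -FG.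
have h2 : partial_sum G (box (A `|` A')%fset) - partial_sum G (box A) <
          e / 4%:R + e / 4%:R.
  rewrite -[ltLHS]ger0_norm; last by apply: le_trans h1.
  rewrite !psum_box.
  rewrite [X in `|X|](_ : _ =
      (\prod_i S i - \prod_i partial_sum (g i) A) -
      (\prod_i S i - \prod_i partial_sum (g i) (A `|` A')%fset)); last by ring.
  apply: le_lt_trans (ler_normB _ _) _; apply: ltrD; apply: hA2.
    exact: fsubsetUr.
  by apply: fsubset_trans AA'; exact: fsubsetUr.
have h3 : `|\prod_i s i - partial_sum F (box A)| < e / 4%:R.
  by rewrite psum_box; apply: hA1; exact: fsubsetUl.
rewrite [X in `|X|](_ : _ = (\prod_i s i - partial_sum F (box A)) -
   (partial_sum F B - partial_sum F (box A))); last by ring.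
apply: le_lt_trans (ler_normB _ _) _.
apply: lt_le_trans (ltrD h3 (le_lt_trans h1 h2)) _.
rewrite -subr_ge0 (_ : _ - _ = e / 4%:R) ?ltW //; by field.
Qed.

End Product.

Section ComplexSums.
Variables (R : realType) (I : choiceType).

Lemma has_sum_ge0 (g : I -> R) (M : R) :
  (forall i, 0 <= g i) -> (forall A, partial_sum g A <= M) ->
  exists s, has_sum g s.
Proof.
move=> g0 gM; pose E := [set partial_sum g A | A in setT].
have hE : has_sup E.
  split; first by exists (partial_sum g fset0); exists fset0.
  by exists M => _ [A _ <-].
exists (sup E); apply/has_sumP => e e0.
have [_ [A _ <-] hA] := sup_adherent e0 hE.
exists A => B AB.
have AB' : partial_sum g A <= partial_sum g B.
  rewrite !psumE [leRHS](big_fsetID _ (mem A)) /=.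
  rewrite (_ : [fset x in B | x \in A]%fset = A) ?lerDl ?sumr_ge0 //.
  apply/fsetP => x; rewrite !inE /= andbC.
  by case: (boolP (x \in A)) => // /(fsubsetP AB) ->.
have BE : partial_sum g B <= sup E by apply: sup_upper_bound => //; exists B.
by rewrite ger0_norm ?subr_ge0 //; lra.
Qed.

(** A real family is the difference of the nonnegative families [g + |g|] and
[|g|]. *)
Lemma has_sum_real (g : I -> R) (M : R) :
  (forall A, partial_sum (fun i => `|g i|) A <= M) -> exists s, has_sum g s.
Proof.
move=> gM.
have [t ht] : exists s, has_sum (fun i => `|g i|) s.
  exact: has_sum_ge0 gM.
have [s hs] : exists s, has_sum (fun i => g i + `|g i|) s.
  apply: (@has_sum_ge0 _ (M + M)) => [i|A].
    by rewrite -lerBlDr sub0r lerNnormlW.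
  apply: le_trans (lerD (gM A) (gM A)).
  rewrite -[leRHS]big_split /=; apply: ler_sum => i _.
  by rewrite lerD2r ler_norm.
exists (s + (-1) * t).
have := has_sumD hs (has_sumZ (c := -1) ht).
by congr has_sum; apply/funext => i /=; ring.
Qed.

Lemma has_sum_RtoC (g : I -> R) (s : R) :
  has_sum g s -> has_sum (fun i => (g i)%:C%C : R[i]) s%:C%C.
Proof.
move=> /has_sumP gs; apply/has_sumP => e.
case: e => e i; rewrite ltcE /= => /andP[/eqP-> e0].
have [A hA] := gs e e0; exists A => B /hA.
rewrite (_ : partial_sum _ B = (partial_sum g B)%:C%C); last first.
  by rewrite /partial_sum rmorph_sum.
by rewrite -rmorphB normc_def /= expr0n addr0 sqrtr_sqr -ltcR.
Qed.

(** The real and imaginary parts are dominated by the modulus; the modulus itself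
is included because [has_sum_prod] needs it. *)
Lemma has_sum_abs (f : I -> R[i]) (M : R) :
  (forall A, partial_sum (fun i => ComplexField.Normc.normc (f i)) A <= M) ->
  (exists s, has_sum f s) /\ (exists S, has_sum (fun i => `|f i|) S).
Proof.
move=> fM.
have nE (x : R[i]) : `|x| = (ComplexField.Normc.normc x)%:C%C by [].
have bnd (g : I -> R) : (forall i, `|g i| <= ComplexField.Normc.normc (f i)) ->
    exists s, has_sum (fun i => (g i)%:C%C : R[i]) s.
  move=> gf; have [s hs] : exists s, has_sum g s.
    apply: (@has_sum_real _ M) => A; apply: le_trans (fM A).
    by apply: ler_sum => i _.
  by exists s%:C%C; exact: has_sum_RtoC.
split; last first.
  apply: bnd => i; rewrite ger0_norm //.
  by rewrite -ler0c -nE.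
have [s hs] : exists s, has_sum (fun i => (complex.Re (f i))%:C%C : R[i]) s.
  apply: bnd => i; case: (f i) => a b /=.
  by rewrite -sqrtr_sqr ler_wsqrtr // lerDl sqr_ge0.
have [t ht] : exists s, has_sum (fun i => (complex.Im (f i))%:C%C : R[i]) s.
  apply: bnd => i; case: (f i) => a b /=.
  by rewrite -sqrtr_sqr ler_wsqrtr // lerDr sqr_ge0.
exists (s + 'i%C * t).
have := has_sumD hs (has_sumZ (c := 'i%C) ht).
by congr has_sum; apply/funext => i /=; rewrite -complexE.
Qed.

End ComplexSums.

(** * Exponentially decaying families on lattices *)

Lemma geometric_sum_le (R : realFieldType) (q : R) (N : nat) : 0 < q -> q < 1 ->
  \sum_(m < N) q ^+ m <= (1 - q)^-1.
Proof.
move=> q0 q1; have d0 : 0 < 1 - q by rewrite subr_gt0.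
rewrite -[leRHS]mul1r ler_pdivlMr // mulrC -opprB mulNr -subrX1 opprB.
by rewrite gerBl exprn_ge0 // ltW.
Qed.

(** Uniform bound for families on a copy of a subset of [Z^n] dominated by
[prod_j q^|k_j|].  A finite set of indices injects, by signs and absolute
values, into a box, over which the dominating sum factors into [n] equal sums,
each at most two geometric series. *)
Lemma lattice_psum_le (R : realFieldType) (T : choiceType) (n : nat) (D : pred T)
    (f : T -> R) (k : T -> 'I_n -> int) (q : R) :
  0 < q -> q < 1 ->
  (forall x, x \notin D -> f x = 0) ->
  (forall x, x \in D -> f x <= \prod_j q ^+ `|k x j|%N) ->
  {in D &, forall x y, k x =1 k y -> x = y} ->
  forall A : {fset T}, partial_sum f A <= (2%:R * (1 - q)^-1) ^+ n.
Proof.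
move=> q0 q1 f0 fk kinj A.
(* A bound for the coordinates of all points of [A]. *)
pose N := \max_(x <- A) \max_(j < n) `|k x j|%N.
have kN x j : x \in A -> (`|k x j|%N < N.+1)%N.
  move=> xA; rewrite ltnS /N (big_rem x) //=.
  by apply: leq_trans (leq_maxl _ _); exact: (@leq_bigmax _ (fun j => `|k x j|%N)).
pose h x : {ffun 'I_n -> bool * 'I_N.+1} :=
  [ffun j => (k x j < 0, inord `|k x j|%N)].
pose G (g : {ffun 'I_n -> bool * 'I_N.+1}) : R := \prod_j q ^+ (g j).2.
have G0 g : 0 <= G g by apply: prodr_ge0 => j _; apply: exprn_ge0; exact: ltW.
pose r := [seq x <- A | x \in D].
have rP x : x \in r -> x \in A /\ x \in D by rewrite mem_filter => /andP[].
have hinj : {in r &, injective h}.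
  move=> x y /rP[xA xD] /rP[yA yD] /ffunP hxy; apply: kinj => // j.
  have := hxy j; rewrite !ffunE => -[s /(congr1 val)/=].
  rewrite !inordK ?kN //; lia.
have -> : partial_sum f A = \sum_(x <- r) f x.
  by rewrite psumE big_filter [LHS](bigID (mem D)) /= [X in _ + X]big1 ?addr0.
apply: (@le_trans _ _ (\sum_(x <- r) G (h x))).
  rewrite big_seq [leRHS]big_seq; apply: ler_sum => x /rP[xA xD].
  apply: le_trans (fk _ xD) _; rewrite /G le_eqVlt; apply/orP; left; apply/eqP.
  by apply: eq_bigr => j _; rewrite ffunE /= inordK ?kN.
rewrite -(big_map h xpredT G) big_uniq /=; last first.
  by rewrite map_inj_in_uniq // filter_uniq.
apply: (@le_trans _ _ (\sum_g G g)).
  by rewrite big_mkcond; apply: ler_sum => g _; case: ifP.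
rewrite /G -(bigA_distr_bigA (fun=> fun b : bool * 'I_N.+1 => q ^+ b.2)) /=.
rewrite prodr_const card_ord; apply: lerXn2r; rewrite ?nnegrE.
- by apply: sumr_ge0 => b _; apply: exprn_ge0; exact: ltW.
- by rewrite mulr_ge0 // invr_ge0 subr_ge0 ltW.
rewrite -(pair_bigA _ (fun (_ : bool) (m : 'I_N.+1) => q ^+ m)) /= big_bool /=.
by rewrite mulr_natl mulr2n lerD // geometric_sum_le.
Qed.

(** * The ring F_2 + u F_2 *)

Lemma F2u_two : 2%:R = 0 :> F2u.
Proof. by rewrite -(scaler_nat 2 (1 : F2u)) (_ : 2%:R = 0 :> 'F_2) ?scale0r //; apply/val_inj. Qed.

Lemma F2u_intr_even (k : int) : (2 * k)%:~R = 0 :> F2u.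
Proof. by rewrite intrM (_ : 2%:~R = 0 :> F2u) ?mul0r //; exact: F2u_two. Qed.

Lemma u_poly : (u : {poly 'F_2}) = 'X.
Proof. by rewrite /u qpolyXE ?monicXn ?size_polyXn. Qed.

Lemma u_neq0 : u != 0.
Proof.
apply/eqP => /(congr1 (fun x : F2u => (x : {poly 'F_2}))); rewrite u_poly /=.
by move/eqP; rewrite polyX_eq0.
Qed.

Lemma u_neq1 : u != 1.
Proof.
apply/eqP => /(congr1 (fun x : F2u => size (x : {poly 'F_2}))); rewrite u_poly /=.
by rewrite size_polyX size_polyC oner_eq0.
Qed.

Lemma F2u_add1 : 1 + 1 = 0 :> F2u.
Proof. exact: F2u_two. Qed.

Lemma u1_neq0 : 1 + u != 0.
Proof.
apply/eqP => /(congr1 (+%R 1)); rewrite addrA F2u_add1 add0r addr0 => /eqP.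
by rewrite (negPf u_neq1).
Qed.

Lemma F2u_cases (a : F2u) : [\/ a = 0, a = 1, a = 1 + u | a = u].
Proof.
have c4 : #|{: F2u}| = 4%N.
  by rewrite card_monic_qpoly ?monicXn ?size_polyXn // card_Fp.
have un : uniq [:: 0; 1; 1 + u; u].
  rewrite /= !inE !negb_or !andbT eq_sym oner_eq0 eq_sym u1_neq0 eq_sym u_neq0 /=.
  rewrite -subr_eq0 opprD addNKr oppr_eq0 u_neq0 eq_sym u_neq1 /=.
  by rewrite -subr_eq0 addrK oner_eq0.
have : a \in [:: 0; 1; 1 + u; u].
  have sub : {subset [:: 0; 1; 1 + u; u] <= enum F2u} by move=> x _; rewrite mem_enum.
  have [|_ ->] := uniq_min_size un sub; last by rewrite mem_enum.
  by rewrite -cardE c4.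
by rewrite !inE => /or4P[] /eqP ->; [constructor 1|constructor 2|constructor 3|constructor 4].
Qed.

Lemma int_parity (m : int) : (exists k, m = 2 * k) \/ (exists k, m = 1 + 2 * k).
Proof.
have [->|->] : m = 2 * (m %/ 2)%Z \/ m = 1 + 2 * (m %/ 2)%Z by lia.
  by left; eexists.
by right; eexists.
Qed.

(** [1] and [1 + u] form a basis over the prime field, so vanishing is the pair of
parity conditions that also describes [Lambda] inside its dual. *)
Lemma F2u_coord_eq0 (m k : int) : m%:~R + k%:~R * (1 + u) = 0 <->
  (exists i, m = 2 * i) /\ (exists j, k = 2 * j).
Proof.
split; last by move=> [[i ->] [j ->]]; rewrite !F2u_intr_even mul0r add0r.
case: (int_parity m) (int_parity k) => -[i ->] [] [j ->];
  rewrite ?(rmorphD (intr : {rmorphism int -> F2u}) 1) /= !F2u_intr_even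
    !(addr0, mul0r, mul1r, add0r).
- by move=> _; split; [exists i | exists j].
- by move=> /eqP; rewrite (negPf u1_neq0).
- by move=> /eqP; rewrite oner_eq0.
- by rewrite addrA F2u_add1 add0r => /eqP; rewrite (negPf u_neq0).
Qed.

(** * The complex exponential and weights of codewords *)

Section ComplexExponential.
Variable R : realType.
Implicit Types w : R[i].

Lemma cexpD w1 w2 : cexp (w1 + w2) = cexp w1 * cexp w2.
Proof.
case: w1 w2 => [a1 b1] [a2 b2]; rewrite /cexp /= expRD cosD sinD.
by simpc; congr Complex; ring.
Qed.

Lemma cexp0 : cexp (0 : R[i]) = 1.
Proof. by rewrite /cexp /= expR0 cos0 sin0 mul1r. Qed.

Lemma cexp_sum (I : Type) (r : seq I) (P : pred I) (w : I -> R[i]) :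
  cexp (\sum_(i <- r | P i) w i) = \prod_(i <- r | P i) cexp (w i).
Proof. exact: (big_morph _ cexpD cexp0). Qed.

Lemma normc_cexp w : ComplexField.Normc.normc (cexp w) = expR (complex.Re w).
Proof.
rewrite /cexp ComplexField.Normc.normcM /= cos2Dsin2 sqrtr1 mulr1.
by rewrite expr0n addr0 sqrtr_sqr ger0_norm // expR_ge0.
Qed.

End ComplexExponential.

(** The symmetrised weight enumerator identifies [1] and [1 + u], whence the
hypothesis. *)
Lemma prod_weight (S : comNzRingType) (n : nat) (X : F2u -> S) (x : 'rV[F2u]_n) :
  X (1 + u) = X 1 ->
  \prod_i X (x 0 i) = X 0 ^+ N0 x * X 1 ^+ N1 x * X u ^+ N2 x.
Proof.
move=> Xu; have u0 := u_neq0.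
have X1 a : a != 0 -> a != u -> X a = X 1.
  by case: (F2u_cases a) => ->; rewrite ?eqxx.
pose P1 := [pred i | (x 0 i != 0) && (x 0 i != u)].
have E0 : #|[pred i | x 0 i == 0]| = N0 x by rewrite /N0 cardsE.
have Eu : #|[pred i | (x 0 i != 0) && (x 0 i == u)]| = N2 x.
  rewrite /N2 -[LHS]cardsE; apply: eq_card => i; rewrite !inE andbC.
  by case: (x 0 i =P u) => [->|_]; rewrite ?u0 ?andbF.
have E1 : #|P1| = N1 x.
  have : (\sum_(i < n) 1 = N0 x + (N2 x + #|P1|))%N.
    rewrite (bigID (fun i => x 0 i == 0)) /= sum1_card E0; congr addn.
    by rewrite (bigID (fun i => x 0 i == u)) /= !sum1_card Eu.
  by rewrite /N1 sum1_card card_ord; lia.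
rewrite (bigID (fun i => x 0 i == 0)) /= -mulrA; congr (_ * _).
  by rewrite (eq_bigr (fun=> X 0)) => [|i /eqP-> //]; rewrite prodr_const E0.
rewrite (bigID (fun i => x 0 i == u)) /= mulrC; congr (_ * _).
  rewrite (eq_bigr (fun=> X 1)) => [|i /andP[? ?]]; last exact: X1.
  by rewrite prodr_const E1.
rewrite (eq_bigr (fun=> X u)) => [|i /andP[_ /eqP->] //].
by rewrite prodr_const Eu.
Qed.

(** * The field of eighth roots of unity *)

Lemma sqr_rat_neq2 (x : rat) : x ^+ 2 != 2%:R.
Proof.
apply/eqP => x2.
have n2 : numq x ^+ 2 = 2%:R * denq x ^+ 2.
  apply: (intr_inj (R := rat)); rewrite rmorphXn rmorphM rmorphXn.
  rewrite rmorph_nat -x2 -{2}[x]divq_num_den expr_div_n divfK //.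
  by rewrite expf_neq0 // intr_eq0 denq_neq0.
have := congr1 (fun k : int => logn 2 `|k|) n2.
rewrite abszM !abszX lognM ?expn_gt0 ?absz_gt0 ?denq_neq0 // !lognX /=.
have -> : logn 2 `|2%:R : int| = 1%N by [].
lia.
Qed.

(** For [c = 1 / sqrt 2], this is the irrationality of the square root of 2. *)
Lemma rat_sqrt_half_indep (R : realType) (c : R) (p q : rat) :
  2%:R * c ^+ 2 = 1 -> ratr p + c * ratr q = 0 -> p = 0 /\ q = 0.
Proof.
move=> c2 pq0.
have pq : 2%:R * p ^+ 2 = q ^+ 2.
  apply: (fmorph_inj (ratr : {rmorphism rat -> R})).
  rewrite rmorphM !rmorphXn rmorph_nat /=.
  have -> : ratr p = - (c * ratr q) :> R by apply/eqP; rewrite -addr_eq0 pq0.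
  by rewrite sqrrN exprMn mulrA c2 mul1r.
have p0 : p = 0.
  apply/eqP/negPn/negP => p0; have /eqP := sqr_rat_neq2 (q / p); apply.
  by rewrite expr_div_n -pq mulfK // expf_neq0.
by move: pq; rewrite p0 expr0n mulr0 => /esym/eqP; rewrite sqrf_eq0 => /eqP.
Qed.

(** Integrality transfers to the algebraic complex numbers, where rational
algebraic integers are known to be integers. *)
Lemma rat_integral (F : fieldExtType rat) (r : rat) :
  integralOver (intr : int -> F) (r%:A) -> r \is a Num.int.
Proof.
move=> [p pm rp].
have rpQ : root (map_poly intr p) r.
  rewrite -(fmorph_root (in_alg F)) -map_poly_comp.
  rewrite (eq_map_poly (g := intr)) // => k.
  by rewrite -[LHS]/(GRing.in_alg F k%:~R) rmorph_int.
have rpC : root (map_poly intr p) (ratr r : algC).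
  have := rpQ; rewrite -(fmorph_root (ratr : {rmorphism rat -> algC})) -map_poly_comp.
  by rewrite (eq_map_poly (g := intr)) // => k /=; rewrite rmorph_int.
have : (ratr r : algC) \in Aint.
  apply: root_monic_Aint rpC _ _; first exact: monic_map.
  by apply/polyOverP => i; rewrite coef_map /=.
move=> /(Cint_rat_Aint (Crat_rat r)) /intrP[m rm].
apply/intrP; exists m; apply: (fmorph_inj (ratr : {rmorphism rat -> algC})).
by rewrite rmorph_int; exact: rm.
Qed.

Section CyclotomicField.
Variables (R : realType) (F : splittingFieldType rat) (zeta : F).
Hypothesis F_gen : <<1; zeta>>%VS = fullv.
Variable iota : {rmorphism F -> R[i]}.
Hypothesis iota_zeta : iota zeta = cexp (2%:R * (pi : R)%:C%C * 'i / 8%:R).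

Let c : R := cos (pi / 4%:R).

Lemma cos_pi4_sqr : 2%:R * c ^+ 2 = 1.
Proof.
have := cos_mulr2n (pi / 4%:R : R); rewrite (_ : (pi / 4%:R) *+ 2 = pi / 2 :> R); last by field.
by rewrite cos_pihalf -/c => /eqP; rewrite eq_sym subr_eq0 mulr_natl => /eqP.
Qed.

Lemma iota_zetaE : iota zeta = (c +i* c)%C.
Proof.
have sc : sin (pi / 4%:R : R) = c.
  by rewrite -cosBpihalf -cosN; congr cos; field.
rewrite iota_zeta /cexp.
have -> : (2%:R * (pi : R)%:C%C * 'i / 8%:R = (0 +i* (pi / 4%:R))%C :> R[i]).
  have -> : (0 +i* (pi / 4%:R))%C = 'i%C * ((pi / 4%:R)%:C)%C :> R[i] by simpc.
  rewrite fmorph_div rmorph_nat; change ('i : R[i])%R with ('i%C : R[i]).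
  by field.
by rewrite /= expR0 mul1r sc.
Qed.

Lemma zeta4 : zeta ^+ 4 = -1.
Proof.
apply: (fmorph_inj iota); rewrite rmorphXn rmorphN1 iota_zetaE.
have c2 := cos_pi4_sqr.
have -> : (c +i* c)%C ^+ 4 = (- (2%:R * c ^+ 2) ^+ 2)%:C%C :> R[i].
  rewrite !exprS expr0; simpc; apply/eqP; rewrite eq_complex /=.
  by apply/andP; split; apply/eqP; ring.
by rewrite c2 expr1n rmorphN1.
Qed.

Local Notation "q %:F" := (GRing.in_alg F q) (at level 1, format "q %:F").

Definition zcomb (a0 a1 a2 a3 : rat) : F :=
  a0%:F + a1%:F * zeta + a2%:F * zeta ^+ 2 + a3%:F * zeta ^+ 3.

Lemma iota_rat a : iota a%:F = (ratr a)%:C%C.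
Proof.
apply: etrans (fmorph_eq_rat (iota \o GRing.in_alg F) a) (esym _).
exact: (fmorph_eq_rat (real_complex R \o ratr) a).
Qed.

Lemma iota_zcomb a0 a1 a2 a3 : iota (zcomb a0 a1 a2 a3) =
  ((ratr a0 + c * ratr (a1 - a3)) +i* (ratr a2 + c * ratr (a1 + a3)))%C.
Proof.
rewrite !(rmorphD, rmorphXn, rmorphM) !iota_rat iota_zetaE /=.
have c2 := cos_pi4_sqr.
rewrite !exprS expr0; simpc; apply/eqP; rewrite eq_complex /=.
have cc : c * c + c * c = 1 by rewrite -c2; ring.
rewrite !rmorphN /= !cc.
by apply/andP; split; apply/eqP; ring.
Qed.

(** The real and imaginary parts of the image in the complex numbers have the form
[p + q / sqrt 2] with [p] and [q] rational. *)
Lemma zcomb_eq0 a0 a1 a2 a3 : zcomb a0 a1 a2 a3 = 0 ->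
  [/\ a0 = 0, a1 = 0, a2 = 0 & a3 = 0].
Proof.
move=> /(congr1 iota); rewrite iota_zcomb rmorph0 => -[].
have c2 := cos_pi4_sqr.
move=> /(rat_sqrt_half_indep c2)[-> h1] /(rat_sqrt_half_indep c2)[-> h2].
by split=> //; lra.
Qed.

Lemma zcombB a0 a1 a2 a3 b0 b1 b2 b3 :
  zcomb a0 a1 a2 a3 - zcomb b0 b1 b2 b3 =
  zcomb (a0 - b0) (a1 - b1) (a2 - b2) (a3 - b3).
Proof. by rewrite /zcomb; ring. Qed.

Lemma zcombD a0 a1 a2 a3 b0 b1 b2 b3 :
  zcomb a0 a1 a2 a3 + zcomb b0 b1 b2 b3 =
  zcomb (a0 + b0) (a1 + b1) (a2 + b2) (a3 + b3).
Proof. by rewrite /zcomb; ring. Qed.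

Lemma zcombM a0 a1 a2 a3 b0 b1 b2 b3 :
  zcomb a0 a1 a2 a3 * zcomb b0 b1 b2 b3 =
  zcomb (a0 * b0 - a1 * b3 - a2 * b2 - a3 * b1)
        (a0 * b1 + a1 * b0 - a2 * b3 - a3 * b2)
        (a0 * b2 + a1 * b1 + a2 * b0 - a3 * b3)
        (a0 * b3 + a1 * b2 + a2 * b1 + a3 * b0).
Proof. by rewrite /zcomb; have z4 := zeta4; ring: z4. Qed.

Lemma zcomb_inj a0 a1 a2 a3 b0 b1 b2 b3 :
  zcomb a0 a1 a2 a3 = zcomb b0 b1 b2 b3 ->
  [/\ a0 = b0, a1 = b1, a2 = b2 & a3 = b3].
Proof.
move=> /eqP; rewrite -subr_eq0 zcombB => /eqP/zcomb_eq0[].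
by do 4![move=> /eqP; rewrite subr_eq0 => /eqP ->].
Qed.

Lemma ratE_zcomb a : a%:F = zcomb a 0 0 0.
Proof. by rewrite /zcomb; ring. Qed.

Lemma zetaE_zcomb : zeta = zcomb 0 1 0 0.
Proof. by rewrite /zcomb; ring. Qed.

(** Polynomials in [zeta] reduce modulo [X^4 + 1]. *)
Lemma zcomb_spans x : exists a0 a1 a2 a3, x = zcomb a0 a1 a2 a3.
Proof.
have /Fadjoin_polyP[p p1 ->] : x \in <<1; zeta>>%VS by rewrite F_gen memvf.
elim/poly_ind: p p1 => [|p k IH] pk.
  by exists 0, 0, 0, 0; rewrite horner0 -ratE_zcomb rmorph0.
have [|a0 [a1 [a2 [a3 E]]]] := IH.
  apply/polyOverP => i; move/polyOverP/(_ i.+1): pk.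
  by rewrite coefD coefMX coefC /= addr0.
have [q kq] : exists q : rat, k = q%:F.
  move/polyOverP/(_ 0%N): pk; rewrite coefD coefMX coefC /= add0r.
  by move=> /vlineP[q ->]; exists q.
rewrite hornerD hornerM hornerX hornerC E kq.
exists (q - a3), a0, a1, a2.
by rewrite /zcomb; have z4 := zeta4; ring: z4.
Qed.

(** The value chosen by [bar] is the intended one: the image of [iota] is stable
under conjugation, which maps [zeta] to its inverse. *)
Lemma iota_bar x : iota (bar iota x) = (iota x)^*.
Proof.
rewrite /bar; case: xgetP => [y -> //|] /=.
have [a0 [a1 [a2 [a3 ->]]]] := zcomb_spans x.
move=> /(_ (zcomb a0 (- a3) (- a2) (- a1))); case; rewrite /= !iota_zcomb.
rewrite -[RHS]/(conjc _) /=; congr Complex.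
  by congr (_ + _ * ratr _); ring.
by rewrite !(rmorphN, rmorphD) /=; ring.
Qed.

Lemma bar_zcomb a0 a1 a2 a3 :
  bar iota (zcomb a0 a1 a2 a3) = zcomb a0 (- a3) (- a2) (- a1).
Proof.
apply: (fmorph_inj iota); rewrite iota_bar !iota_zcomb.
rewrite -[LHS]/(conjc _) /=; congr Complex.
  by congr (_ + _ * ratr _); ring.
by rewrite !(rmorphN, rmorphD) /=; ring.
Qed.

(** * The dual basis and the trace *)

(** [f_j^*] is this constant times a power of [zeta], so that integral
combinations of the dual basis are [fscale] times elements of [Z[zeta]]. *)
Definition fscale : F := (2%:R * (1 - zeta^-1))^-1.

Lemma zeta_neq0 : zeta != 0.
Proof.
apply/eqP => z0; have := zeta4; rewrite z0 expr0n /= => /eqP.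
by rewrite eq_sym oppr_eq0 oner_eq0.
Qed.

Lemma zetaV : zeta^-1 = - zeta ^+ 3.
Proof.
apply: (mulfI zeta_neq0); rewrite divff ?zeta_neq0 // mulrN -exprS zeta4.
by rewrite opprK.
Qed.

Lemma zcomb1 : 1 = zcomb 1 0 0 0.
Proof. by rewrite /zcomb; ring. Qed.

Lemma zcomb0 : 0 = zcomb 0 0 0 0.
Proof. by rewrite /zcomb; ring. Qed.

(** [1 - zeta^-1 = 1 + zeta^3], and [(1 + y) (1 - y + y^2 - y^3) = 2] when
[y^4 = -1]. *)
Lemma fscaleE : fscale = zcomb 4%:R^-1 (- 4%:R^-1) (- 4%:R^-1) (- 4%:R^-1).
Proof.
rewrite /fscale zetaV; set x := 2%:R * _; set y := zcomb _ _ _ _.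
have xy : x * y = 1.
  have -> : x = zcomb 2%:R 0 0 2%:R by rewrite /x /zcomb; ring.
  rewrite /y zcombM zcomb1.
  by congr zcomb; field.
have x0 : x != 0.
  by apply/eqP => x0; move: xy; rewrite x0 mul0r => /eqP; rewrite eq_sym oner_eq0.
by apply: (mulfI x0); rewrite divff.
Qed.

Lemma fscale_neq0 : fscale != 0.
Proof.
apply/eqP; rewrite fscaleE zcomb0.
by move=> /zcomb_inj[].
Qed.

Lemma ord4_inord : [/\ ord0 = inord 0 :> 'I_4, lift ord0 ord0 = inord 1 :> 'I_4,
  lift ord0 (lift ord0 ord0) = inord 2 :> 'I_4 &
  lift ord0 (lift ord0 (lift ord0 ord0)) = inord 3 :> 'I_4].
Proof. by split; apply: val_inj; rewrite /= inordK. Qed.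

Lemma sum_fstar (k : 'I_4 -> rat) :
  \sum_(i < 4) k i *: fstar zeta i =
  fscale * zcomb (k (inord 0)) (k (inord 1)) (k (inord 2)) (k (inord 3)).
Proof.
rewrite !big_ord_recl big_ord0.
have [<- <- <- <-] := ord4_inord.
rewrite -![_ *: fstar _ _]mulr_algl -!in_algE /fstar /zcomb -/fscale.
by rewrite /= /bump /=; ring.
Qed.

Definition fbasis := [tuple fstar zeta k | k < 4].

Lemma nth_fbasis (i : 'I_4) : fbasis`_i = fstar zeta i.
Proof. by rewrite -tnth_nth tnth_mktuple. Qed.

Lemma fbasis_free : free fbasis.
Proof.
apply/freeP => k; under eq_bigr do rewrite nth_fbasis.
rewrite sum_fstar => /eqP; rewrite mulf_eq0 (negPf fscale_neq0) /=.
move=> /eqP/zcomb_eq0[k0 k1 k2 k3] i.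
have -> : i = inord i by rewrite inord_val.
by case: i => -[|[|[|[|//]]]] i4 /=.
Qed.

Lemma ord4_tuple (T : Type) (m0 m1 m2 m3 : T) : exists k : 'I_4 -> T,
  [/\ k (inord 0) = m0, k (inord 1) = m1, k (inord 2) = m2 & k (inord 3) = m3].
Proof.
by exists (fun i => nth m0 [:: m0; m1; m2; m3] i); split; rewrite inordK.
Qed.

Lemma fcoord_fscale m0 m1 m2 m3 :
  [/\ fcoord zeta (fscale * zcomb m0 m1 m2 m3) (inord 0) = numq m0,
      fcoord zeta (fscale * zcomb m0 m1 m2 m3) (inord 1) = numq m1,
      fcoord zeta (fscale * zcomb m0 m1 m2 m3) (inord 2) = numq m2
    & fcoord zeta (fscale * zcomb m0 m1 m2 m3) (inord 3) = numq m3].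
Proof.
have [k [k0 k1 k2 k3]] := ord4_tuple m0 m1 m2 m3.
have E j : fcoord zeta (fscale * zcomb m0 m1 m2 m3) j = numq (k j).
  rewrite -k0 -k1 -k2 -k3 -sum_fstar /fcoord.
  under eq_bigr do rewrite -nth_fbasis.
  by rewrite coord_sum_free // fbasis_free.
by rewrite !E k0 k1 k2 k3.
Qed.

Lemma fscale_spans x : exists m0 m1 m2 m3, x = fscale * zcomb m0 m1 m2 m3.
Proof.
have [m0 [m1 [m2 [m3 E]]]] := zcomb_spans (fscale^-1 * x).
by exists m0, m1, m2, m3; rewrite -E mulVKf ?fscale_neq0.
Qed.

Lemma dimF : \dim {:F} = 4%N.
Proof.
have b : basis_of {:F} fbasis.
  rewrite /basis_of fbasis_free andbT eqEsubv subvf /=; apply/subvP => x _.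
  have [m0 [m1 [m2 [m3 ->]]]] := fscale_spans x.
  have [k [<- <- <- <-]] := ord4_tuple m0 m1 m2 m3.
  rewrite -sum_fstar; apply: memv_suml => i _; apply/memvZ/memv_span.
  by rewrite -nth_fbasis mem_nth // size_tuple.
by rewrite -(size_basis b).
Qed.

Lemma F_galois : galois 1 {:F}.
Proof.
rewrite /galois sub1v normalFieldf andbT /=.
apply/separableP => x _; apply: pcharf0_separable => p.
by rewrite pchar_lalg pchar_num.
Qed.

Lemma gal_rat (E : {subfield F}) (g : gal_of E) (q : rat) : g q%:F = q%:F.
Proof. by rewrite /= linearZ /= rmorph1. Qed.

(** The conjugates of [zeta] are [zeta], [- zeta], [zeta^3] and [- zeta^3], so an
automorphism permutes the other three basis elements up to sign. *)
Lemma gal_coef0 (g : gal_of {:F}) a0 a1 a2 a3 :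
  exists b1 b2 b3, g (zcomb a0 a1 a2 a3) = zcomb a0 b1 b2 b3.
Proof.
have gz4 : g zeta ^+ 4 = -1 by rewrite -rmorphXn zeta4 rmorphN1.
have gE : g (zcomb a0 a1 a2 a3) =
    a0%:F + a1%:F * g zeta + a2%:F * g zeta ^+ 2 + a3%:F * g zeta ^+ 3.
  rewrite /zcomb !(rmorphD, rmorphXn, rmorphM) /= !linearZ /=.
  by rewrite !rmorph1.
have : (g zeta - zeta) * (g zeta + zeta) * (g zeta - zeta ^+ 3) * (g zeta + zeta ^+ 3) = 0.
  by have z4 := zeta4; ring: gz4 z4.
rewrite {}gE; move/eqP; rewrite !mulf_eq0 -!orbA !subr_eq0 !addr_eq0.
have z4 := zeta4.
case/or4P => /eqP ->.
- by exists a1, a2, a3.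
- by exists (- a1), a2, (- a3); rewrite /zcomb; ring.
- by exists a3, (- a2), a1; rewrite /zcomb; ring: z4.
- by exists (- a3), (- a2), (- a1); rewrite /zcomb; ring: z4.
Qed.

(** Summing over the group multiplies the constant coordinate by 4; the trace is
rational, so the other coordinates vanish by independence. *)
Lemma TrF_zcomb a0 a1 a2 a3 : TrF (zcomb a0 a1 a2 a3) = (4%:R * a0)%:F.
Proof.
have card4 : #|'Gal({:F} / 1)%g| = 4%N.
  by rewrite -galois_dim ?F_galois // dimv1 divn1 dimF.
have [b1 [b2 [b3 E]]] : exists b1 b2 b3,
    TrF (zcomb a0 a1 a2 a3) = zcomb (4%:R * a0) b1 b2 b3.
  rewrite -card4 mulr_natl -sumr_const /TrF /galTrace.
  elim/big_ind2: _ => [|x1 x2 y1 y2 [b1 [b2 [b3 ->]]] [d1 [d2 [d3 ->]]]|g _].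
  - by exists 0, 0, 0; rewrite -ratE_zcomb rmorph0.
  - by exists (b1 + d1), (b2 + d2), (b3 + d3); rewrite zcombD.
  - exact: gal_coef0.
have : TrF (zcomb a0 a1 a2 a3) \in 1%VS by rewrite mem_galTrace ?F_galois ?memvf.
rewrite E => /vlineP[q]; rewrite -[RHS]/(q%:F) ratE_zcomb => /zcomb_inj[_ -> -> ->].
by rewrite -ratE_zcomb.
Qed.

(** * The ring of integers *)

Notation isint := (integralOver (intr : int -> F)).

Definition zint (m0 m1 m2 m3 : int) : F :=
  zcomb m0%:~R m1%:~R m2%:~R m3%:~R.

Lemma isint1 : isint 1.
Proof. exact: (integral1 (intr : {rmorphism int -> F})). Qed.

Lemma isint_add x y : isint x -> isint y -> isint (x + y).
Proof. exact: (integral_add (RtoK := intr : {rmorphism int -> F})). Qed.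

Lemma isint_mul x y : isint x -> isint y -> isint (x * y).
Proof. exact: (integral_mul (RtoK := intr : {rmorphism int -> F})). Qed.

Lemma isint_exp x k : isint x -> isint (x ^+ k).
Proof.
move=> xi; elim: k => [|k IH]; first exact: isint1.
by rewrite exprS; exact: isint_mul.
Qed.

Lemma isint_zeta : isint zeta.
Proof.
exists ('X^4 - (-1)%:P); first exact: monicXnsubC.
by rewrite rmorphB /= map_polyXn map_polyC /= rootE !hornerE zeta4 rmorphN1 subrr.
Qed.

Lemma isint_rat (m : int) : isint (m%:~R)%:F.
Proof. by rewrite rmorph_int; exact: (integral_id (intr : {rmorphism int -> F})). Qed.

Lemma isint_zint m0 m1 m2 m3 : isint (zint m0 m1 m2 m3).
Proof.
have q := isint_rat; have z := isint_zeta.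
by do !apply: isint_add; rewrite ?q //; apply: isint_mul => //; exact: isint_exp.
Qed.

Lemma isint_TrF x : isint x -> isint (TrF x).
Proof.
move=> xi; rewrite /TrF /galTrace; elim/big_ind: _ => [|y w|g _].
- exact: (mxpoly.integral0 (intr : {rmorphism int -> F})).
- exact: isint_add.
have := integral_rmorph g xi.
rewrite (_ : g \o _ = intr) //; apply/funext => k /=.
by rewrite rmorph_int.
Qed.

Lemma isint_4coef0 a0 a1 a2 a3 : isint (zcomb a0 a1 a2 a3) ->
  exists m : int, a0 = m%:~R / 4%:R.
Proof.
move=> /isint_TrF; rewrite TrF_zcomb => /rat_integral/intrP[m E].
by exists m; rewrite -E; field.
Qed.

(** Multiplying by [- zeta^3] brings each coordinate in turn to the constant
position, where the trace reads four times its value. *)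
Lemma isint_4coefs a0 a1 a2 a3 : isint (zcomb a0 a1 a2 a3) ->
  exists m0 m1 m2 m3 : int,
    [/\ a0 = m0%:~R / 4%:R, a1 = m1%:~R / 4%:R,
        a2 = m2%:~R / 4%:R & a3 = m3%:~R / 4%:R].
Proof.
move=> h; have [m0 E0] := isint_4coef0 h.
have shift b0 b1 b2 b3 : isint (zcomb b0 b1 b2 b3) -> isint (zcomb b1 b2 b3 (- b0)).
  move=> /(isint_mul (isint_zint 0 0 0 (-1))); rewrite /zint zcombM.
  by congr (isint (zcomb _ _ _ _)); ring.
have h1 := shift _ _ _ _ h; have [m1 E1] := isint_4coef0 h1.
have h2 := shift _ _ _ _ h1; have [m2 E2] := isint_4coef0 h2.
have h3 := shift _ _ _ _ h2; have [m3 E3] := isint_4coef0 h3.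
by exists m0, m1, m2, m3.
Qed.

(** The prime [1 - zeta] above 2. *)
Definition zpi : F := zint 1 (-1) 0 0.

Lemma zpi4 : zpi ^+ 4 = 2%:R * zint 0 (-2) 3 (-2).
Proof. by rewrite /zpi /zint /zcomb; have z := zeta4; ring: z. Qed.

(** The fourth power of [b zpi^3 / 2] is [b^4 / 2] times a unit. *)
Lemma even_of_isint_zpi3 (b : int) :
  isint ((b%:~R / 2)%:F * zpi ^+ 3) -> exists s, b = 2 * s.
Proof.
move=> h.
(* The inverse cube of the unit [zpi^4 / 2]:
   [zeta^2 (99 + 70 sqrt 2)], where [(3 + 2 sqrt 2)^3 = 99 + 70 sqrt 2]. *)
pose w := zint 0 70 99 70.
have : isint (((b%:~R / 2)%:F * zpi ^+ 3) ^+ 4 * w).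
  by apply: isint_mul (isint_zint _ _ _ _); exact: isint_exp.
have -> : ((b%:~R / 2)%:F * zpi ^+ 3) ^+ 4 * w = (b%:~R ^+ 4 / 2)%:F.
  have -> : b%:~R ^+ 4 / 2 = 8 * (b%:~R / 2) ^+ 4 :> rat by field.
  have ew : zint 0 (-2) 3 (-2) ^+ 3 * w = 1.
    rewrite /w /zint !exprS expr0 mulr1 !zcombM zcomb1.
    by congr zcomb; ring.
  move: (b%:~R / 2) => q.
  transitivity (q%:F ^+ 4 * (zpi ^+ 4) ^+ 3 * w); first by ring.
  by rewrite zpi4 exprMn -mulrA -[_ * w]mulrA ew; ring.
move=> /rat_integral/intrP[t tE].
have {}tE : b ^+ 4 = 2 * t.
  apply: (intr_inj (R := rat)); rewrite rmorphXn rmorphM /= -tE.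
  by field.
have : (2 %| b)%Z.
  have : (2 %| b ^+ 4)%Z by rewrite tE dvdz_mulr.
  rewrite !dvdzE abszX -[absz 2]/2%N.
  by rewrite Euclid_dvdX // => /andP[].
by move=> /dvdzP[s ->]; exists s; rewrite mulrC.
Qed.

(** Modulo [zpi] every [zeta^j] is 1.  If [zpi^k y / 2] is integral, so is
[zpi^3 y / 2], and as [zpi^4 / 2] is a unit only the residue of [y] modulo [zpi]
contributes a non-integral part; hence that residue, the sum of the coordinates,
is even.  It can then be subtracted, and the remainder is divisible by
[zpi]. *)
Lemma zpi_step (k : nat) (m0 m1 m2 m3 : int) : (k <= 3)%N ->
  isint (zpi ^+ k * zcomb (m0%:~R / 2) (m1%:~R / 2) (m2%:~R / 2) (m3%:~R / 2)) ->
  (exists s, m0 + m1 + m2 + m3 = 2 * s) /\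
  isint (zpi ^+ k.+1 * zcomb ((m1 + m2 + m3)%:~R / 2) ((m2 + m3)%:~R / 2) (m3%:~R / 2) 0).
Proof.
move=> k3 h.
have zpiX j : isint (zpi ^+ j) by apply: isint_exp; exact: isint_zint.
have zm : zcomb (m0%:~R / 2) (m1%:~R / 2) (m2%:~R / 2) (m3%:~R / 2) =
    ((m0 + m1 + m2 + m3)%:~R / 2)%:F -
    zpi * zcomb ((m1 + m2 + m3)%:~R / 2) ((m2 + m3)%:~R / 2) (m3%:~R / 2) 0.
  rewrite /zpi zcombM ratE_zcomb zcombB !rmorphD /=.
  by congr zcomb; field.
have z4 := zpi4.
have [s sE] : exists s, m0 + m1 + m2 + m3 = 2 * s.
  apply: even_of_isint_zpi3.
  have := isint_add (isint_mul (zpiX (3 - k)%N) h)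
     (isint_mul (isint_zint 0 (-2) 3 (-2)) (isint_zint (m1 + m2 + m3) (m2 + m3) m3 0)).
  rewrite mulrA -exprD subnK // zm.
  set y := zcomb _ _ _ 0.
  have -> : zint (m1 + m2 + m3) (m2 + m3) m3 0 = 2%:R * y.
    have -> : 2%:R = zcomb 2%:R 0 0 0 by rewrite /zcomb; ring.
    by rewrite /zint /y zcombM; congr zcomb; field.
  by congr integralOver; ring: z4.
split; first by exists s.
have := isint_add (isint_mul (zpiX k) (isint_rat s))
   (isint_mul (isint_rat (-1)) h).
rewrite zm sE; congr integralOver.
have -> : ((2 * s)%:~R / 2 = s%:~R :> rat) by rewrite rmorphM /=; field.
by rewrite exprSr; ring.
Qed.

(** Four steps of [zpi_step] make the coefficients of the expansion in powers of
[zpi] even; the change of basis is unimodular. *)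
Lemma isint_half m0 m1 m2 m3 :
  isint (zcomb (m0%:~R / 2) (m1%:~R / 2) (m2%:~R / 2) (m3%:~R / 2)) ->
  exists n0 n1 n2 n3, [/\ m0 = 2 * n0, m1 = 2 * n1, m2 = 2 * n2 & m3 = 2 * n3].
Proof.
rewrite -[zcomb _ _ _ _]mul1r -(expr0 zpi) => /zpi_step [//|[s0 e0]].
rewrite -[X in zcomb _ _ _ X](mul0r (2^-1)) => /(@zpi_step 1 _ _ _ 0) [//|[s1 e1]].
rewrite -[X in zcomb _ _ _ X](mul0r (2^-1)) => /(@zpi_step 2 _ _ _ 0) [//|[s2 e2]].
rewrite -[X in zcomb _ _ _ X](mul0r (2^-1)) => /(@zpi_step 3 _ _ _ 0) [//|[s3 e3] _].
(* The sums are [m0 + m1 + m2 + m3], [m1 + 2 m2 + 3 m3], [m2 + 3 m3], [m3]. *)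
exists (s0 - s1 + s2 - s3), (s1 - 2 * s2 + 3 * s3), (s2 - 3 * s3), s3; split; lia.
Qed.

Lemma ringOfIntegersP x : ringOfIntegers x <->
  exists m0 m1 m2 m3, x = zint m0 m1 m2 m3.
Proof.
split; last by case=> m0 [m1 [m2 [m3 ->]]]; exact: isint_zint.
have [a0 [a1 [a2 [a3 ->]]]] := zcomb_spans x.
rewrite /ringOfIntegers /= => h.
have [m0 [m1 [m2 [m3 [E0 E1 E2 E3]]]]] := isint_4coefs h.
have h2 : isint (zcomb (m0%:~R / 2) (m1%:~R / 2) (m2%:~R / 2) (m3%:~R / 2)).
  have := isint_mul (isint_zint 2 0 0 0) h; rewrite /zint zcombM.
  by rewrite E0 E1 E2 E3; congr (isint (zcomb _ _ _ _)); field.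
have [n0 [n1 [n2 [n3 [M0 M1 M2 M3]]]]] := isint_half h2.
have D (k : int) : (2 * k)%:~R / 4%:R = k%:~R / 2 :> rat.
  by rewrite rmorphM /=; field.
move: h; rewrite E0 E1 E2 E3 M0 M1 M2 M3 !D => h.
have [l0 [l1 [l2 [l3 [-> -> -> ->]]]]] := isint_half h.
have D' (k : int) : (2 * k)%:~R / 2 = k%:~R :> rat.
  by rewrite rmorphM /=; field.
by exists l0, l1, l2, l3; rewrite !D'.
Qed.

(** * The lattice and its dual *)

Lemma LambdaP y : Lambda zeta y <->
  exists m0 m1 m2 m3, y = zcomb 2^-1 (- 2^-1) 0 0 * zint m0 m1 m2 m3.
Proof.
have half : (1 - zeta) / 2%:R = zcomb 2^-1 (- 2^-1) 0 0.
  rewrite /zcomb rmorphN !fmorphV !rmorph_nat; move: (2%:R^-1 : F) => h; ring.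
rewrite -half /Lambda; split=> [[w /ringOfIntegersP[m0 [m1 [m2 [m3 ->]]]] <-]|].
  by exists m0, m1, m2, m3.
move=> [m0 [m1 [m2 [m3 ->]]]]; exists (zint m0 m1 m2 m3) => //.
by apply/ringOfIntegersP; exists m0, m1, m2, m3.
Qed.

(** The [f_j] and the [f_j^*] are dual bases for the trace form. *)
Lemma TrF_pairing a0 a1 a2 a3 b0 b1 b2 b3 :
  TrF (fscale * zcomb a0 a1 a2 a3 *
       bar iota (zcomb 2^-1 (- 2^-1) 0 0 * zcomb b0 b1 b2 b3)) =
  (a0 * b0 + a1 * b1 + a2 * b2 + a3 * b3)%:F.
Proof.
rewrite fscaleE !zcombM bar_zcomb zcombM TrF_zcomb; congr (_ %:F).
by field.
Qed.

Lemma Lambda_dualP x : Lambda_dual zeta iota x <->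
  exists m0 m1 m2 m3, x = fscale * zint m0 m1 m2 m3.
Proof.
split=> [|[m0 [m1 [m2 [m3 ->]]]] y /LambdaP[n0 [n1 [n2 [n3 ->]]]]]; last first.
  exists (m0 * n0 + m1 * n1 + m2 * n2 + m3 * n3).
  rewrite /zint TrF_pairing -[RHS](rmorph_int (GRing.in_alg F)) !rmorphD !rmorphM.
  by [].
have [a0 [a1 [a2 [a3 ->]]]] := fscale_spans x => h.
have pair n0 n1 n2 n3 : exists k : int,
    a0 * n0%:~R + a1 * n1%:~R + a2 * n2%:~R + a3 * n3%:~R = k%:~R.
  have [|k] := h (zcomb 2^-1 (- 2^-1) 0 0 * zint n0 n1 n2 n3).
    by apply/LambdaP; exists n0, n1, n2, n3.
  rewrite /zint TrF_pairing -[RHS](rmorph_int (GRing.in_alg F)) => /fmorph_inj E.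
  by exists k.
have [k0 K0] := pair 1 0 0 0; have [k1 K1] := pair 0 1 0 0.
have [k2 K2] := pair 0 0 1 0; have [k3 K3] := pair 0 0 0 1.
exists k0, k1, k2, k3; rewrite /zint; congr (_ * zcomb _ _ _ _).
- by rewrite -K0; ring.
- by rewrite -K1; ring.
- by rewrite -K2; ring.
- by rewrite -K3; ring.
Qed.

Lemma rho1_fscale m0 m1 m2 m3 :
  rho1 zeta (fscale * zint m0 m1 m2 m3) =
  (m0 + m2)%:~R + (m1 + m3)%:~R * (1 + u).
Proof.
rewrite /rho1 /zint.
have [-> -> -> ->] := fcoord_fscale m0%:~R m1%:~R m2%:~R m3%:~R.
by rewrite !numq_int.
Qed.

(** [Lambda] is [(1 - zeta) (1 - zeta^-1) = 2 - zeta + zeta^3] times its dual.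
A multiple of this element has even sums of coordinates two places apart, and its
inverse is [(2 + zeta - zeta^3) / 2]. *)
Lemma Lambda_fscale m0 m1 m2 m3 :
  Lambda zeta (fscale * zint m0 m1 m2 m3) <->
  (exists k, m0 + m2 = 2 * k) /\ (exists l, m1 + m3 = 2 * l).
Proof.
rewrite /zint fscaleE zcombM; split.
  move=> /LambdaP[n0 [n1 [n2 [n3]]]]; rewrite /zint zcombM => /zcomb_inj[h0 h1 h2 h3].
  have toZ (a b : int) : a%:~R = b%:~R :> rat -> a = b by move/intr_inj.
  split; [exists (n0 - n1 + n2) | exists (n1 - n2 + n3)]; apply: toZ.
    rewrite !(rmorphD, rmorphM, rmorphB) /=; lra.
  rewrite !(rmorphD, rmorphM, rmorphB) /=; lra.
move=> [[k kE] [l lE]].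
have -> : m2 = 2 * k - m0 by lia.
have -> : m3 = 2 * l - m1 by lia.
(* The coordinates of [(m0, m1, m2, m3) * (2 + zeta - zeta^3) / 2]. *)
apply/LambdaP; exists (m0 + m1 - l), (m1 + k), (2 * k - m0 + l), (2 * l - m1 + k - m0).
rewrite /zint zcombM.
by congr zcomb; rewrite !(rmorphD, rmorphM, rmorphB, rmorphN) /=; field.
Qed.

Lemma fscale_zintB m0 m1 m2 m3 n0 n1 n2 n3 :
  fscale * zint m0 m1 m2 m3 - fscale * zint n0 n1 n2 n3 =
  fscale * zint (m0 - n0) (m1 - n1) (m2 - n2) (m3 - n3).
Proof. by rewrite -mulrBr zcombB /zint !rmorphB. Qed.

Lemma Lambda_sub_dual y : Lambda zeta y -> Lambda_dual zeta iota y.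
Proof.
move=> /LambdaP[n0 [n1 [n2 [n3 ->]]]]; apply/Lambda_dualP.
(* The coordinates of [(n0, n1, n2, n3) * (2 - zeta + zeta^3)]. *)
exists (2 * n0 - n1 + n3), (2 * n1 - n0 - n2), (2 * n2 - n1 - n3), (2 * n3 - n2 + n0).
rewrite /zint fscaleE !zcombM.
by congr zcomb; rewrite !(rmorphD, rmorphM, rmorphB) /=; field.
Qed.

(** The representatives lie in the span of [f_1^*] and [f_2^*], on which [rho] maps
coordinates [(p, q)] to [p + q (1 + u)]. *)
Lemma coset_repE (a : F2u) : exists p q : int,
  a = p%:~R + q%:~R * (1 + u) /\ coset_rep zeta a = fscale * zint p q 0 0.
Proof.
have f0 : fstar zeta (inord 0) = fscale * zint 1 0 0 0.
  by rewrite /fstar inordK // /zint /zcomb -/fscale; ring.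
have f1 : fstar zeta (inord 1) = fscale * zint 0 1 0 0.
  by rewrite /fstar inordK // /zint /zcomb -/fscale; ring.
have h1 : u == 1 = false by apply/negbTE/u_neq1.
have h0 : u == 0 = false by apply/negbTE/u_neq0.
have h2 : 1 + u == 1 = false by rewrite -subr_eq0 addrC addKr.
rewrite /coset_rep; case: (F2u_cases a) => ->.
- exists 0, 0; rewrite eqxx mul0r addr0; split=> //.
  by rewrite /zint -zcomb0 mulr0.
- by exists 1, 0; rewrite oner_eq0 eqxx mul0r addr0.
- exists 0, 1; rewrite (negPf u1_neq0) h2 eqxx mul1r add0r; split=> //.
- exists 1, 1; rewrite h0 h1 [u == _]eq_sym -subr_eq0 addrK oner_eq0.
  rewrite mul1r addrA F2u_add1 add0r; split=> //.
  by rewrite f0 f1 -mulrDr zcombD /zint; congr (_ * zcomb _ _ _ _); ring.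
Qed.

(** The fibre of [rho] over [a] is the coset of [Lambda] used in [theta_a]. *)
Lemma Lambda_cosetP x (a : F2u) : Lambda zeta (x - coset_rep zeta a) <->
  Lambda_dual zeta iota x /\ rho1 zeta x = a.
Proof.
have [p [q [aE cE]]] := coset_repE a; rewrite cE.
have fiber m0 m1 m2 m3 :
    Lambda zeta (fscale * zint m0 m1 m2 m3 - fscale * zint p q 0 0) <->
    rho1 zeta (fscale * zint m0 m1 m2 m3) = a.
  rewrite fscale_zintB rho1_fscale !subr0.
  have -> : (m0 + m2)%:~R + (m1 + m3)%:~R * (1 + u) = a <->
      (m0 - p + m2)%:~R + (m1 - q + m3)%:~R * (1 + u) = 0.
    rewrite aE !rmorphD !rmorphN /=; split=> [/eqP|/eqP] h; apply/eqP.
      by rewrite -subr_eq0 in h; rewrite -(eqP h); apply/eqP; ring.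
    by rewrite -subr_eq0 -(eqP h); apply/eqP; ring.
  by rewrite F2u_coord_eq0; exact: Lambda_fscale.
split=> [h|[/Lambda_dualP[m0 [m1 [m2 [m3 ->]]]] /fiber]] //.
have /Lambda_dualP[m0 [m1 [m2 [m3 E]]]] := Lambda_sub_dual h.
have {}E : x = fscale * zint (m0 + p) (m1 + q) m2 m3.
  have -> : zint (m0 + p) (m1 + q) m2 m3 = zint m0 m1 m2 m3 + zint p q 0 0.
    by rewrite /zint zcombD !rmorphD /= !addr0.
  by rewrite mulrDr -E subrK.
rewrite E in h *; split; last exact/fiber.
by apply/Lambda_dualP; exists (m0 + p), (m1 + q), m2, m3.
Qed.

(** [zeta] is a unit of finite order 8, so one inclusion gives the other. *)
Lemma Lambda_zeta y : Lambda zeta (zeta * y) <-> Lambda zeta y.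
Proof.
have half x : Lambda zeta x -> Lambda zeta (zeta * x).
  move=> /LambdaP[n0 [n1 [n2 [n3 ->]]]]; apply/LambdaP.
  exists (- n3), n0, n1, n2; rewrite /zint zetaE_zcomb !zcombM.
  by congr zcomb; rewrite ?rmorphN /=; ring.
split; last exact: half.
move=> /half/half/half/half/half/half/half.
by congr (Lambda zeta _); have z4 := zeta4; ring: z4.
Qed.

(** * The quadratic form under the two embeddings of K *)

Variable sigma2 : gal_of (K zeta).
Hypothesis GalK : 'Gal(K zeta / 1%AS)%g = [set 1%g; sigma2]%SET.

Lemma sqrt2E : zeta + zeta^-1 = zcomb 0 1 0 (-1).
Proof. by rewrite zetaV /zcomb; ring. Qed.

Let s2 := zeta + zeta^-1.

Lemma sqrt2_sqr : s2 ^+ 2 = 2%:R.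
Proof.
rewrite /s2 sqrt2E expr2 zcombM.
have -> : 2%:R = zcomb 2%:R 0 0 0 by rewrite /zcomb; ring.
by congr zcomb; ring.
Qed.

Lemma sqrt2_neq0 : s2 != 0.
Proof.
by apply/eqP; rewrite /s2 sqrt2E => /zcomb_eq0[_ /eqP]; rewrite oner_eq0.
Qed.

(** [K] is the splitting field of [X^2 - 2]. *)
Lemma K_galois : galois 1 (K zeta).
Proof.
apply/splitting_galoisField; exists ('X^2 - (2%:R)%:P).
have pE : 'X^2 - (2%:R)%:P = \prod_(x <- [:: s2; - s2]) ('X - x%:P) :> {poly F}.
  rewrite !big_cons big_nil mulr1 polyCN opprK -subr_sqr.
  by rewrite -polyC_exp sqrt2_sqr.
split.
- by rewrite rpredB ?polyOverXn ?polyOverC ?rpred_nat.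
- rewrite pE separable_prod_XsubC /= inE andbT -addr_eq0 -mulr2n -mulr_natl.
  by rewrite mulf_eq0 -sqrt2_sqr expf_eq0 /= orbb sqrt2_neq0.
exists [:: s2; - s2]; first by rewrite pE eqpxx.
rewrite adjoin_cons adjoin_seq1.
have /Fadjoin_idP -> // : - s2 \in <<1; s2>>%AS.
by rewrite rpredN memv_adjoin.
Qed.

(** Otherwise [sigma2] would be trivial, and the Galois group of order 1 would force
the square root of 2 to be rational. *)
Lemma sigma2_sqrt2 : sigma2 s2 = - s2.
Proof.
have sG : sigma2 \in 'Gal(K zeta / 1%AS)%g by rewrite GalK !inE eqxx orbT.
have : (sigma2 s2 - s2) * (sigma2 s2 + s2) = 0.
  by rewrite -subr_sqr -rmorphXn sqrt2_sqr rmorph_nat subrr.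
move=> /eqP; rewrite mulf_eq0 subr_eq0 addr_eq0 => /orP[/eqP fix2|/eqP //].
have s1 : sigma2 = 1%g.
  apply/eqP; rewrite gal_adjoin_eq //.
  by rewrite gal_id; exact/eqP.
have := galois_dim K_galois; rewrite GalK s1 finset.setUid cards1 dimv1 divn1 => dK.
have : s2 \in 1%VS.
  have -> : 1%VS = K zeta :> {vspace F}.
    by apply/eqP; rewrite eqEdim sub1v dimv1 dK.
  by rewrite memv_adjoin.
rewrite /s2 sqrt2E => /vlineP[q]; rewrite -[RHS]/(q%:F) ratE_zcomb => /zcomb_inj[_ /eqP].
by rewrite oner_eq0.
Qed.

(** The contribution of one coordinate to [v . v]. *)
Definition qnorm (x : F) : F := x * bar iota x + bar iota x * x.

Lemma qnorm_zcomb a0 a1 a2 a3 (q := a0 * a1 + a1 * a2 + a2 * a3 - a3 * a0) :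
  qnorm (zcomb a0 a1 a2 a3) =
  (2%:R * (a0 ^+ 2 + a1 ^+ 2 + a2 ^+ 2 + a3 ^+ 2))%:F + (2%:R * q)%:F * s2.
Proof.
rewrite /qnorm /s2 sqrt2E bar_zcomb !ratE_zcomb !zcombM !zcombD.
by rewrite /q; congr zcomb; ring.
Qed.

Lemma sigma2_qnorm_zcomb a0 a1 a2 a3 (q := a0 * a1 + a1 * a2 + a2 * a3 - a3 * a0) :
  sigma2 (qnorm (zcomb a0 a1 a2 a3)) =
  (2%:R * (a0 ^+ 2 + a1 ^+ 2 + a2 ^+ 2 + a3 ^+ 2))%:F - (2%:R * q)%:F * s2.
Proof.
rewrite qnorm_zcomb -/q; move: (2%:R * (_ + _)) (2%:R * q) => p r.
have -> : sigma2 (p%:F + r%:F * s2) = sigma2 p%:F + sigma2 r%:F * sigma2 s2.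
  by rewrite rmorphD rmorphM.
by rewrite !gal_rat sigma2_sqrt2 mulrN.
Qed.

Lemma iota_sqrt2 : iota s2 = (2%:R * c)%:C%C.
Proof.
rewrite /s2 sqrt2E iota_zcomb opprK subrr (_ : 1 + 1 = 2%:R :> rat) //.
by rewrite !rmorph0 rmorph_nat; congr Complex; ring.
Qed.

Lemma iota_sqrt2_comb p r :
  (iota (p%:F + r%:F * s2) = (ratr p + ratr r * (2%:R * c))%:C%C) *
  (iota (p%:F - r%:F * s2) = (ratr p + ratr r * (2%:R * - c))%:C%C).
Proof.
have E t : iota (t%:F * s2) = (ratr t * (2%:R * c))%:C%C.
  by rewrite rmorphM [iota s2]iota_sqrt2 [iota t%:F]iota_rat -rmorphM.
split; first by rewrite rmorphD E [iota p%:F]iota_rat -rmorphD.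
by rewrite rmorphB E [iota p%:F]iota_rat -rmorphB !mulrN.
Qed.

(** With [e = 1 / sqrt 2] or its opposite, both embeddings of [qnorm x] are
twice a sum of two squares; in the sum of the two the mixed terms cancel. *)
Lemma iota_qnorms x a0 a1 a2 a3 : x = zcomb a0 a1 a2 a3 -> exists A1 A2 : R,
  [/\ iota (qnorm x) = A1%:C%C, iota (sigma2 (qnorm x)) = A2%:C%C,
      0 <= A1, 0 <= A2 &
      A1 + A2 = 4%:R * (ratr a0 ^+ 2 + ratr a1 ^+ 2 + ratr a2 ^+ 2 + ratr a3 ^+ 2)].
Proof.
move=> ->.
pose A (e : R) : R := 2%:R * ((ratr a0 + e * (ratr a1 - ratr a3)) ^+ 2 +
                              (ratr a2 + e * (ratr a1 + ratr a3)) ^+ 2).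
have AE e : 2%:R * e ^+ 2 = 1 ->
    A e = 2%:R * (ratr a0 ^+ 2 + ratr a1 ^+ 2 + ratr a2 ^+ 2 + ratr a3 ^+ 2) +
    (2%:R * (ratr a0 * ratr a1 + ratr a1 * ratr a2 + ratr a2 * ratr a3 - ratr a3 * ratr a0)) * (2%:R * e).
  move=> e2; rewrite /A.
  transitivity (2%:R * (ratr a0 ^+ 2 + ratr a2 ^+ 2 + (2%:R * e ^+ 2) * (ratr a1 ^+ 2 + ratr a3 ^+ 2)) +
    (2%:R * (ratr a0 * ratr a1 + ratr a1 * ratr a2 + ratr a2 * ratr a3 - ratr a3 * ratr a0)) * (2%:R * e)).
    by ring.
  by rewrite e2; ring.
have c2 := cos_pi4_sqr.
have A0 e : 0 <= A e by rewrite mulr_ge0 // addr_ge0 // sqr_ge0.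
exists (A c), (A (- c)); split=> //.
- rewrite qnorm_zcomb iota_sqrt2_comb AE //.
  by congr (_%:C)%C; ring.
- rewrite sigma2_qnorm_zcomb iota_sqrt2_comb AE ?sqrrN //.
  by congr (_%:C)%C; ring.
by rewrite !AE ?sqrrN //; ring.
Qed.

(** * Theta functions *)

Variable z : R[i] * R[i].
Hypotheses (z1_H : upper_half_plane z.1) (z2_H : upper_half_plane z.2).

Definition theta_exponent (x : F) : R[i] :=
  z.1 * iota (qnorm x) + z.2 * iota (sigma2 (qnorm x)).

Definition theta_term (x : F) : R[i] :=
  cexp ((pi : R)%:C%C * 'i * theta_exponent x).

Lemma TrK_sum (n : nat) (v : 'rV[F]_n) :
  TrK iota sigma2 z v = \sum_i theta_exponent (v 0 i).
Proof.
by rewrite /TrK gal_id /dot !rmorph_sum !mulr_sumr -big_split.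
Qed.

Lemma theta_term_prod (n : nat) (v : 'rV[F]_n) :
  cexp ((pi : R)%:C%C * 'i * TrK iota sigma2 z v) = \prod_i theta_term (v 0 i).
Proof. by rewrite TrK_sum mulr_sumr cexp_sum. Qed.

(** [zeta] has absolute value 1 under both embeddings. *)
Lemma theta_term_zeta x : theta_term (zeta * x) = theta_term x.
Proof.
have [a0 [a1 [a2 [a3 ->]]]] := zcomb_spans x.
rewrite /theta_term /theta_exponent (_ : qnorm _ = qnorm (zcomb a0 a1 a2 a3)) //.
rewrite zetaE_zcomb zcombM !qnorm_zcomb.
by congr (_%:F + _%:F * _); ring.
Qed.

Lemma normc_theta_term x a0 a1 a2 a3 (y : R) : x = zcomb a0 a1 a2 a3 ->
  y <= complex.Im z.1 -> y <= complex.Im z.2 ->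
  ComplexField.Normc.normc (theta_term x) <=
  expR (- (4%:R * pi * y * (ratr a0 ^+ 2 + ratr a1 ^+ 2 + ratr a2 ^+ 2 + ratr a3 ^+ 2))).
Proof.
move=> xE y1 y2; rewrite normc_cexp ler_expR /theta_exponent.
have [A1 [A2 [-> -> A1_0 A2_0 A12]]] := iota_qnorms xE.
have -> : complex.Re ((pi : R)%:C%C * 'i * (z.1 * A1%:C%C + z.2 * A2%:C%C)) =
    - (pi * (complex.Im z.1 * A1 + complex.Im z.2 * A2)).
  change ('i : R[i])%R with ('i%C : R[i]).
  case: z => -[p1 q1] [p2 q2] /=; by simpc.
rewrite lerN2.
rewrite (_ : 4%:R * pi * y * _ = pi * (y * (A1 + A2))); last by rewrite A12; ring.
rewrite ler_wpM2l ?pi_ge0 // mulrDr lerD // ler_wpM2r //.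
Qed.

(** The bound is uniform in [D] so that all cosets are handled at once.  A square of
an integer is at least its absolute value, which turns the Gaussian terms into
geometric ones. *)
Lemma theta_term_bound : exists M : R, forall (D : set F),
  D `<=` Lambda_dual zeta iota -> forall A : {fset F},
  partial_sum (fun x => ComplexField.Normc.normc
    (if x \in D then theta_term x else 0)) A <= M.
Proof.
pose y := Num.min (complex.Im z.1) (complex.Im z.2).
have y0 : 0 < y by rewrite lt_min; apply/andP; split.
pose q := expR (- (pi * y / 4%:R)).
have q0 : 0 < q by apply: expR_gt0.
have q1 : q < 1 by rewrite expR_lt1 oppr_lt0 divr_gt0 // mulr_gt0 // pi_gt0.
have /choice[k kE] : forall x, exists k : 'I_4 -> int, Lambda_dual zeta iota x ->
    x = zcomb ((k (inord 0))%:~R / 4%:R) ((k (inord 1))%:~R / 4%:R)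
              ((k (inord 2))%:~R / 4%:R) ((k (inord 3))%:~R / 4%:R).
  move=> x; case: (pselect (Lambda_dual zeta iota x)) => [|nx]; last by exists (fun=> 0).
  move=> /Lambda_dualP[m0 [m1 [m2 [m3 ->]]]].
  (* [4 * fscale = 1 - zeta - zeta^2 - zeta^3] has integral coordinates. *)
  have [k [k0 k1 k2 k3]] := ord4_tuple (m0 + m1 + m2 + m3) (m1 + m2 + m3 - m0)
    (m2 + m3 - m0 - m1) (m3 - m0 - m1 - m2).
  exists k => _; rewrite k0 k1 k2 k3 fscaleE /zint zcombM.
  by congr zcomb; rewrite !(rmorphD, rmorphN) /=; field.
exists ((2%:R * (1 - q)^-1) ^+ 4) => D DL.
apply: (@lattice_psum_le _ _ _ (fun x => x \in D) _ k) => //.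
- by move=> x /negPf xD; move: xD; rewrite unfold_in /= => ->; exact: ComplexField.Normc.normc0.
- move=> x; rewrite unfold_in /= => xD; rewrite xD.
  have Lx : Lambda_dual zeta iota x by apply: DL; exact: set_mem xD.
  apply: le_trans (normc_theta_term (kE x Lx) (y := y) _ _) _.
  + by rewrite ge_min lexx.
  + by rewrite ge_min lexx orbT.
  have kq (m : int) : q ^+ (`|m| ^ 2) <= q ^+ `|m|.
    rewrite ler_wiXn2l ?ltW //; nia.
  apply: (@le_trans _ _ (\prod_j q ^+ (`|k x j| ^ 2))); last first.
    by apply: ler_prod => j _; rewrite kq exprn_ge0 // ltW.
  rewrite prodrXr /q -expRM_natl ler_expR.
  rewrite !big_ord_recl big_ord0 addn0.
  have [-> -> -> ->] := ord4_inord.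
  have sq (m : int) : (`|m| ^ 2)%:R = m%:~R ^+ 2 :> R.
    by rewrite natrX natr_absz intr_norm real_normK ?num_real.
  have rq (m : int) : ratr (m%:~R / 4%:R) = m%:~R / 4%:R :> R.
    by rewrite fmorph_div /= ratr_int rmorph_nat.
  rewrite !natrD !sq !rq le_eqVlt; apply/orP; left; apply/eqP.
  by field.
move=> x x' xD xD' kk; rewrite unfold_in /= in xD; rewrite unfold_in /= in xD'.
by rewrite (kE x (DL _ (set_mem xD))) (kE x' (DL _ (set_mem xD'))) !kk.
Qed.


Lemma has_sum_theta (D : set F) : D `<=` Lambda_dual zeta iota ->
  (exists s, has_sum (fun x => if x \in D then theta_term x else 0) s) /\
  (exists S, has_sum (fun x => `|if x \in D then theta_term x else 0|) S).
Proof.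
move=> DL; have [M hM] := theta_term_bound.
by apply: (has_sum_abs (M := M)) => A; exact: hM.
Qed.

Definition theta_coset (a : F2u) : set F := [set x | Lambda zeta (x - coset_rep zeta a)].

Lemma theta_coset_dual a : theta_coset a `<=` Lambda_dual zeta iota.
Proof. by move=> x /Lambda_cosetP[]. Qed.

Definition coset_term (a : F2u) (x : F) : R[i] :=
  if x \in theta_coset a then theta_term x else 0.

Lemma has_sum_coset a : has_sum (coset_term a) (theta_elt iota sigma2 a z) /\
  exists S, has_sum (fun x => `|coset_term a x|) S.
Proof.
have [[s hs] hS] := has_sum_theta (@theta_coset_dual a).
have h1 : cancel (fun v : 'rV[F]_1 => v 0 0) (fun x => const_mx x).
  by move=> v; apply/rowP => i; rewrite mxE ord1.
have h2 : cancel (fun x => const_mx x : 'rV[F]_1) (fun v : 'rV[F]_1 => v 0 0).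
  by move=> x; rewrite mxE.
have E : theta_elt iota sigma2 a z = s.
  rewrite /theta_elt /theta /csum; apply: sum_has_sum.
  have := has_sum_bij h1 h2 hs.
  set f := (f in has_sum f s); set g := (f in _ -> has_sum f s).
  suff -> : g = f by [].
  apply/funext => v; rewrite /f /g /=.
  by rewrite theta_term_prod big_ord1.
by rewrite E; split.
Qed.

(** Reindexing by [x |-> zeta x], which maps the coset of [f_1^*] onto the coset of
[f_2^*]. *)
Lemma theta_elt_unit : theta_elt iota sigma2 (1 + u) z = theta_elt iota sigma2 1 z.
Proof.
have [h1 _] := has_sum_coset 1; have [hu _] := has_sum_coset (1 + u).
have zK : cancel ( *%R zeta) ( *%R zeta^-1) by exact: (mulKf zeta_neq0).
have zVK : cancel ( *%R zeta^-1) ( *%R zeta) by exact: (mulVKf zeta_neq0).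
have hz := has_sum_bij zK zVK hu.
rewrite -(sum_has_sum h1) -(sum_has_sum hz).
suff -> : coset_term (1 + u) \o *%R zeta = coset_term 1 by [].
apply/funext => x /=.
rewrite /coset_term theta_term_zeta.
rewrite (_ : (zeta * x \in _) = (x \in theta_coset 1)) //.
have E : zeta * x - coset_rep zeta (1 + u) = zeta * (x - coset_rep zeta 1).
  have h2 : 1 + u == 1 = false by rewrite -subr_eq0 addrC addKr; exact/negbTE/u_neq0.
  rewrite /coset_rep (negPf u1_neq0) h2 !eqxx oner_eq0 /fstar !inordK //.
  by ring.
apply/idP/idP => /set_mem; rewrite /theta_coset /= ?E.
  by move=> /Lambda_zeta h; apply/mem_set.
by move=> h; apply/mem_set; rewrite /= E; apply/Lambda_zeta.
Qed.

(** The disjoint union of products of cosets, in terms of summands: at most one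
codeword, [rho v], contributes to the right-hand side. *)
Lemma Gamma_term (n : nat) (C : {set 'rV[F2u]_n}) (v : 'rV[F]_n) :
  (if v \in Gamma zeta iota C
   then cexp ((pi : R)%:C%C * 'i * TrK iota sigma2 z v) else 0) =
  \sum_(x in C) \prod_i coset_term (x 0 i) (v 0 i).
Proof.
have cT a y : coset_term a y =
    if (y \in Lambda_dual zeta iota) && (rho1 zeta y == a) then theta_term y else 0.
  rewrite /coset_term (_ : (y \in theta_coset a) =
    (y \in Lambda_dual zeta iota) && (rho1 zeta y == a)) //.
  apply/idP/andP => [/set_mem/Lambda_cosetP[h ->]|[/set_mem h /eqP r]].
    by split=> //; apply/mem_set.
  by apply/mem_set/Lambda_cosetP.
have [L|nL] := pselect (forall i, Lambda_dual zeta iota (v 0 i)); last first.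
  rewrite ifF; last by apply/negbTE/negP => /set_mem[].
  have [i Li] : exists i, ~ Lambda_dual zeta iota (v 0 i) by exact/existsNP.
  rewrite big1 // => x _; rewrite (bigD1 i) //= cT.
  by rewrite (_ : (v 0 i \in _) = false) ?mul0r //; apply/negbTE/negP => /set_mem.
have cR (x : 'rV[F2u]_n) : \prod_i coset_term (x 0 i) (v 0 i) =
    if x == rho zeta v then \prod_i theta_term (v 0 i) else 0.
  case: eqP => [->|/eqP xv].
    by apply: eq_bigr => i _; rewrite cT mxE eqxx andbT mem_set.
  have /existsP[i ix] : [exists i, x 0 i != rho zeta v 0 i].
    apply: contraR xv; rewrite negb_exists => /forallP h.
    have hx i : x 0 i = rho zeta v 0 i by apply/eqP; have := h i; rewrite negbK.
    by apply/eqP/rowP.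
  rewrite (bigD1 i) //= cT (_ : (_ == x 0 i) = false) ?andbF ?mul0r //.
  by move: ix; rewrite mxE eq_sym => /negbTE.
under eq_bigr do rewrite cR.
rewrite -big_mkcondr /= theta_term_prod.
case: (boolP (rho zeta v \in C)) => vC.
  rewrite ifT; last by apply/mem_set.
  rewrite (bigD1 (rho zeta v)) /= ?vC ?eqxx // [X in _ + X]big1 ?addr0 //.
  by move=> x /andP[/andP[_ /eqP->]]; rewrite eqxx.
rewrite ifF; last by apply/negbTE/negP => /set_mem[_] /=; rewrite (negPf vC).
by rewrite big1 // => x /andP[xC /eqP xv]; move: vC; rewrite -xv xC.
Qed.

Lemma theta_codeE (n : nat) (C : {set 'rV[F2u]_n}) :
  theta_code iota sigma2 C z =
  weight_enumerator C (theta_elt iota sigma2 0 z)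
                      (theta_elt iota sigma2 1 z)
                      (theta_elt iota sigma2 u z).
Proof.
pose X a := theta_elt iota sigma2 a z.
have -> : weight_enumerator C (X 0) (X 1) (X u) = \sum_(x in C) \prod_i X (x 0 i).
  by apply: eq_bigr => x _; rewrite (prod_weight _ theta_elt_unit).
rewrite /theta_code /theta /csum; apply: sum_has_sum.
under eq_fun do rewrite Gamma_term.
apply: has_sum_sum => x _.
pose S a := xget 0 [set S | has_sum (fun y => `|coset_term a y|) S].
apply: (@has_sum_prod _ _ _ (fun i => coset_term (x 0 i))
  (fun i => X (x 0 i)) (fun i => S (x 0 i))) => i.
  by have [] := has_sum_coset (x 0 i).
have [_ [S0 hS]] := has_sum_coset (x 0 i).
by rewrite /S; case: xgetP => [y _ //|/(_ S0)].
Qed.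

End CyclotomicField.

Theorem theorem4p7
    (R : realType)
    (F : splittingFieldType rat) (zeta : F)
    (F_gen : <<1; zeta>>%VS = fullv)
    (iota : {rmorphism F -> R[i]})
    (iota_zeta : iota zeta = cexp (2%:R * (pi : R)%:C%C * 'i / 8%:R))
    (sigma2 : gal_of (K zeta))
    (GalK : 'Gal(K zeta / 1%AS)%g = [set 1%g; sigma2]%SET)
    (n : nat) (n_ge1 : (1 <= n)%N)
    (C : {set 'rV[F2u]_n})
    (C_code : is_code C) (C_sd : self_dual C)
    (z : R[i] * R[i])
    (z1_H : upper_half_plane z.1) (z2_H : upper_half_plane z.2) :
  theta_code iota sigma2 C z =
  weight_enumerator C (theta_elt iota sigma2 0 z)
                      (theta_elt iota sigma2 1 z)
                      (theta_elt iota sigma2 u z).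
Proof. exact: (theta_codeE F_gen iota_zeta GalK z1_H z2_H). Qed.
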